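(* If $\mathcal A_1$ and $\mathcal A_2$ are injective operator ideals, then so is $\mathcal A_1\circ\mathcal A_2$.
   Context: Operator ideals are quasi-normed operator ideals $(\mathcal A,\alpha)$ between Banach spaces. Composition: $T\in\mathcal A_1\circ\mathcal A_2(X,Y)$ iff $T=U\circ V$ with $V\in\mathcal A_2(X,Z)$, $U\in\mathcal A_1(Z,Y)$ for some Banach space $Z$. Injective hull: let $B_{Y^*}$ be the closed unit ball of $Y^*$ and $i_Y:Y\hookrightarrow\ell_\infty(B_{Y^*})$, $i_Y(y)=(y^*(y))_{y^*\in B_{Y^*}}$; then $T\in\mathcal A^{inj}(X,Y)$ iff $i_Y\circ T\in\mathcal A(X,\ell_\infty(B_{Y^*}))$. $\mathcal A$ is injective if $\mathcal A^{inj}=\mathcal A$. *)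

(* Defs.v *)
From HB Require Import structures.
From mathcomp Require Import all_boot all_order all_algebra.
From mathcomp Require Import complex.
From mathcomp Require Import all_classical all_reals all_analysis.

Set Implicit Arguments.
Unset Strict Implicit.
Unset Printing Implicit Defensive.

Import Order.TTheory GRing.Theory Num.Theory.
Import numFieldNormedType.Exports.

Local Open Scope classical_set_scope.
Local Open Scope ring_scope.

Variant scalar_kind := RealScalars | ComplexScalars.

Definition scalars (R : realType) (k : scalar_kind) : numFieldType :=
  if k is RealScalars then R else R[i]%C.

Section complex_complete.
Context {R : realType}.

Lemma normc_ge_Im (z : R[i]%C) : ((`|complex.Im z|)%:C)%C <= `|z|.
Proof.
have := normc_ge_Re (z * 'i%C); rewrite ReiNIm normrN normrM.
suff -> : `|'i%C : R[i]%C| = 1 by rewrite mulr1.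
by rewrite normc_def /= expr0n expr1n add0r sqrtr1.
Qed.

Lemma complex_complete (F : set_system (R[i]%C : numFieldType)) :
  ProperFilter F -> cauchy F -> cvg F.
Proof.
move=> FF /cauchyP Fc.
have coord (p : R[i]%C -> R) : (forall x y, p (x - y) = p x - p y) ->
    (forall z, ((`|p z|)%:C)%C <= `|z|) -> cvg (p @ F).
  move=> pB ple; apply: cauchy_cvg; apply/cauchyP => e e0.
  have [|z Fz] := Fc (e%:C)%C; first by rewrite ltcR.
  exists (p z); rewrite /nbhs/=; apply: filterS Fz => w /=.
  rewrite /ball/= => zw; rewrite -pB -ltcR; exact: le_lt_trans (ple _) zw.
have /cvg_ex[a Fa] : cvg (@complex.Re R @ F).
  apply: coord => [[? ?] [? ?]//|z]; exact: normc_ge_Re.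
have /cvg_ex[b Fb] : cvg (@complex.Im R @ F).
  apply: coord => [[? ?] [? ?]//|z]; exact: normc_ge_Im.
apply/cvg_ex; exists (a +i* b)%C.
apply/(@cvgrPdist_lt _ (R[i]%C : numFieldType)^o) => e e0.
have er : ((complex.Re e)%:C)%C = e by rewrite RRe_real// gtr0_real.
have Re0 : 0 < complex.Re e / 2 by rewrite divr_gt0// -ltcR er.
move/cvgrPdist_lt/(_ _ Re0) : Fa => Fa.
move/cvgrPdist_lt/(_ _ Re0) : Fb => Fb.
near=> z.
have za : `|a - complex.Re z| < complex.Re e / 2 by near: z.
have zb : `|b - complex.Im z| < complex.Re e / 2 by near: z.
rewrite -er [X in X < _](_ : _ = `|((a - complex.Re z)%:C)%C + 'i%C * ((b - complex.Im z)%:C)%C|); last first.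
  by congr (`|_|); rewrite [LHS]complexE; case: (z).
apply: le_lt_trans (ler_normD _ _) _.
rewrite normrM [`|'i%C|](_ : _ = 1) ?mul1r; last first.
  by rewrite normc_def /= expr0n expr1n add0r sqrtr1.
rewrite [complex.Re e]splitr [X in _ < X]rmorphD/=.
by apply: ltrD; rewrite normc_def /= expr0n addr0 sqrtr_sqr ltcR.
Unshelve. all: by end_near. Qed.

End complex_complete.

Section scalar_reals.
Context {R : realType} {k : scalar_kind}.

Definition real_part : scalars R k -> R :=
  match k return scalars R k -> R with
  | RealScalars => id
  | ComplexScalars => @complex.Re R
  end.

Definition of_real : R -> scalars R k :=
  match k return R -> scalars R k with
  | RealScalars => id
  | ComplexScalars => fun x => (x%:C)%C
  end.

Lemma of_realK x : real_part (of_real x) = x.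
Proof. by rewrite /real_part /of_real; case: k. Qed.

Lemma real_partK z : 0 <= z -> of_real (real_part z) = z.
Proof.
move: z; rewrite /real_part /of_real; case: k => //= z z0.
by rewrite RRe_real// realE z0.
Qed.

Lemma of_realD x y : of_real (x + y) = of_real x + of_real y.
Proof. by rewrite /of_real; case: k => //=; rewrite rmorphD. Qed.

Lemma of_realM x y : of_real (x * y) = of_real x * of_real y.
Proof. by rewrite /of_real; case: k => //=; rewrite rmorphM. Qed.

Lemma ler_of_real x y : (of_real x <= of_real y) = (x <= y).
Proof. by rewrite /of_real; case: k => //=; rewrite lecR. Qed.

Lemma ltr_of_real x y : (of_real x < of_real y) = (x < y).
Proof. by rewrite /of_real; case: k => //=; rewrite ltcR. Qed.

Lemma of_real0 : of_real 0 = 0.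
Proof. by rewrite /of_real; case: k. Qed.

Lemma of_real1 : of_real 1 = 1.
Proof. by rewrite /of_real; case: k. Qed.

Lemma scalars_complete (F : set_system (scalars R k)) :
  ProperFilter F -> cauchy F -> cvg F.
Proof.
move: F; rewrite /scalars; case: k => F FF Fc; first exact: cauchy_cvg.
exact: complex_complete.
Qed.

End scalar_reals.

Definition scalar_space (R : realType) (k : scalar_kind) : Type := (scalars R k)^o.

HB.instance Definition _ (R : realType) (k : scalar_kind) :=
  NormedModule.copy (scalar_space R k) (scalars R k)^o.
HB.instance Definition _ (R : realType) (k : scalar_kind) :=
  Uniform_isComplete.Build (scalar_space R k) (@scalars_complete R k).

Notation banach R k := (completeNormedModType (scalars R k)).

(* Norms in a normed module over R[i] are R[i]-valued; real_norm is the same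
   norm with values in R. *)
Definition real_norm (R : realType) (k : scalar_kind)
  (V : normedModType (scalars R k)) (x : V) : R := real_part `|x|.

Section real_norm_theory.
Context {R : realType} {k : scalar_kind} {V : normedModType (scalars R k)}.
Implicit Types (x y : V).

Lemma real_normE x : of_real (real_norm x) = `|x|.
Proof. exact: real_partK. Qed.

Lemma le_real_norm x (r : R) : (real_norm x <= r) = (`|x| <= of_real r).
Proof. by rewrite -real_normE ler_of_real. Qed.

Lemma real_norm_ge0 x : 0 <= real_norm x.
Proof. by rewrite -(@ler_of_real _ k) real_normE of_real0. Qed.

Lemma real_norm0 : real_norm (0 : V) = 0.
Proof. by rewrite /real_norm normr0 -of_real0 of_realK. Qed.

Lemma real_normD x y : real_norm (x + y) <= real_norm x + real_norm y.
Proof. by rewrite le_real_norm of_realD !real_normE ler_normD. Qed.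

Lemma real_normZ (a : scalars R k) x :
  real_norm (a *: x) = real_part `|a| * real_norm x.
Proof.
by rewrite -[LHS](@of_realK R k) real_normE normrZ -[RHS](@of_realK R k) of_realM
  real_normE real_partK.
Qed.

End real_norm_theory.

Section linfty.
Context (R : realType) (k : scalar_kind) (I : Type).
Local Notation K := (scalars R k).
Local Notation K1 := (scalar_space R k).

Definition bounded_scalar_fun : {pred I -> K1} :=
  [pred f : I -> K1 | f \in (bounded_fun : set (I -> K1))].

Lemma bounded_scalar_funP (f : I -> K1) :
  (f \in bounded_scalar_fun) <-> exists M : R, forall i, real_norm (f i) <= M.
Proof.
rewrite [f \in _]/(f \in (bounded_fun : set (I -> K1))); split.
  move=> /set_mem[M [Mreal Mf]]; exists (real_part (`|M| + 1)) => i.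
  rewrite le_real_norm real_partK ?addr_ge0//; apply: Mf => //=.
  by rewrite (le_lt_trans (real_ler_norm Mreal))// ltrDl.
move=> [M Mf]; apply/mem_set; exists (of_real M); split.
  have [->//|Mneq0] := eqVneq M 0.
    by rewrite of_real0 real0.
  rewrite realE -!of_real0 !ler_of_real; exact: le_total.
move=> x /ltW Mx i _; apply: le_trans Mx.
by rewrite -le_real_norm.
Qed.

Lemma bounded_scalar_fun_submod_closed : submod_closed bounded_scalar_fun.
Proof.
split; first by apply/bounded_scalar_funP; exists 0 => i; rewrite le_real_norm normr0 of_real0.
move=> a f g /bounded_scalar_funP[M Mf] /bounded_scalar_funP[N Ng].
apply/bounded_scalar_funP; exists (real_part `|a| * M + N) => i.
apply: le_trans (real_normD _ _) _; apply: lerD => //.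
rewrite real_normZ ler_wpM2l//.
by rewrite -(@ler_of_real _ k) of_real0 real_partK.
Qed.

HB.instance Definition _ := GRing.isSubmodClosed.Build K (I -> K1)
  bounded_scalar_fun bounded_scalar_fun_submod_closed.

Record linfty := Linfty {
  linfty_fun :> I -> K1;
  linfty_bounded : linfty_fun \in bounded_scalar_fun }.

HB.instance Definition _ := [isSub for linfty_fun].
HB.instance Definition _ := [Choice of linfty by <:].
HB.instance Definition _ := [SubChoice_isSubLmodule of linfty by <:].

Definition linfty_norm (f : linfty) : K :=
  of_real (sup (range (fun i => real_norm (f i)))).

Lemma linfty_has_ubound (f : linfty) :
  has_ubound (range (fun i => real_norm (f i))).
Proof.
have /bounded_scalar_funP[M Mf] := linfty_bounded f.
by exists M => _ [i _ <-].
Qed.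

Lemma linfty_norm_ge (f : linfty) i : `|f i| <= linfty_norm f.
Proof.
rewrite -real_normE ler_of_real.
by apply: ub_le_sup; [exact: linfty_has_ubound|exists i].
Qed.

Lemma linfty_norm_le (f : linfty) (c : K) :
  0 <= c -> (forall i, `|f i| <= c) -> linfty_norm f <= c.
Proof.
move=> c0 fc; rewrite -(real_partK c0) ler_of_real.
have [->|/set0P[_ [i _ _]]] := eqVneq (range (fun i => real_norm (f i))) set0.
  by rewrite sup0 -(@ler_of_real _ k) of_real0 real_partK.
apply: ge_sup; first by exists (real_norm (f i)), i.
by move=> _ [j _ <-]; rewrite le_real_norm real_partK.
Qed.

Lemma linfty_norm_ge0 (f : linfty) : 0 <= linfty_norm f.
Proof.
rewrite -of_real0 ler_of_real.
have [->|/set0P[_ [i _ _]]] := eqVneq (range (fun i => real_norm (f i))) set0.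
  by rewrite sup0.
apply: le_trans (real_norm_ge0 (f i)) _.
by apply: ub_le_sup; [exact: linfty_has_ubound|exists i].
Qed.

Lemma linfty_normD (f g : linfty) :
  linfty_norm (f + g) <= linfty_norm f + linfty_norm g.
Proof.
apply: linfty_norm_le => [|i]; first by rewrite addr_ge0// linfty_norm_ge0.
by apply: le_trans (ler_normD _ _) _; rewrite lerD// linfty_norm_ge.
Qed.

Lemma linfty_normZ (a : K) (f : linfty) :
  linfty_norm (a *: f) = `|a| * linfty_norm f.
Proof.
have le (b : K) (g : linfty) : linfty_norm (b *: g) <= `|b| * linfty_norm g.
  apply: linfty_norm_le => [|i]; first by rewrite mulr_ge0// linfty_norm_ge0.
  by rewrite [`|_|](@normrZ K K1) ler_wpM2l// linfty_norm_ge.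
apply/eqP; rewrite eq_le le /=; have [->|a0] := eqVneq a 0.
  by rewrite normr0 mul0r linfty_norm_ge0.
rewrite -ler_pdivlMl ?normr_gt0// -normfV.
by have := le a^-1 (a *: f); rewrite scalerA mulVf// scale1r.
Qed.

Lemma linfty_norm_eq0 (f : linfty) : linfty_norm f = 0 -> f = 0.
Proof.
move=> f0; apply/val_inj/funext => i.
by apply/normr0_eq0/eqP; rewrite eq_le normr_ge0 -f0 linfty_norm_ge.
Qed.

HB.instance Definition _ := Lmodule_isNormed.Build K linfty
  linfty_normD linfty_normZ linfty_norm_eq0.

Lemma linfty_complete (F : set_system linfty) :
  ProperFilter F -> cauchy F -> cvg F.
Proof.
move=> FF /cauchyP Fc.
have Fball e : 0 < e -> exists f : linfty, \forall g \near F, `|f - g| < e.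
  by move=> /Fc[f Ff]; exists f.
have Fi (i : I) : cvg ((fun f : linfty => f i) @ F).
  apply: (@cauchy_cvg K1); apply/cauchyP => e /Fball[f Ff].
  exists (f i); rewrite /nbhs/=; apply: filterS Ff => g fg.
  by rewrite -ball_normE/=; exact: le_lt_trans (linfty_norm_ge (f - g) i) fg.
pose l i : K1 := lim ((fun f : linfty => f i) @ F).
have lP i : (fun f : linfty => f i) @ F --> l i by exact: Fi.
have Fl f e : (\forall g \near F, `|f - g| < e) -> forall i, `|f i - l i| <= e.
  move=> Ff i.
  apply/ler_addgt0Pr => d d0.
  have := @cvgr_dist_le _ K1 _ F FF _ _ (lP i) d d0.
  move=> /filterI/(_ Ff)/filter_ex[g [gl fg]].
  rewrite -(subrKA (g i)); apply: le_trans (ler_normD _ _) _; apply: lerD.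
    exact: le_trans (linfty_norm_ge (f - g) i) (ltW fg).
  by rewrite distrC.
have [f1 Ff1] := Fball 1 ltr01.
have lb : l \in bounded_scalar_fun.
  apply/bounded_scalar_funP; exists (real_part (`|f1| + 1)) => i.
  rewrite le_real_norm real_partK ?addr_ge0// -[l i](subrKC (f1 i)).
  apply: le_trans (ler_normD _ _) _; apply: lerD; first exact: linfty_norm_ge.
  by rewrite distrC; exact: Fl.
apply/cvg_ex; exists (Linfty lb); apply/cvgrPdist_le => e e0.
have e20 : 0 < e / 2 by rewrite divr_gt0.
have [f Ff] := Fball _ e20; apply: filterS (Ff) => g fg.
rewrite -(subrKA f) [e]splitr; apply: le_trans (ler_normD _ _) _.
rewrite lerD// ?(ltW fg)//; apply: linfty_norm_le => [|i]; first exact: ltW.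
by rewrite [X in X <= _]distrC; exact: Fl.
Qed.

HB.instance Definition _ := Uniform_isComplete.Build linfty linfty_complete.

End linfty.

Section operators.
Context {R : realType} {k : scalar_kind}.
Local Notation K := (scalars R k).

Definition bounded_operator (X Y : normedModType K) (T : X -> Y) : Prop :=
  linear T /\ continuous T.

Definition opnorm (X Y : normedModType K) (T : X -> Y) : R :=
  sup [set real_norm (T x) | x in [set x | real_norm x <= 1]].

Lemma opnorm_has_ubound (X Y : normedModType K) (T : X -> Y) :
  bounded_operator T ->
  has_ubound [set real_norm (T x) | x in [set x | real_norm x <= 1]].
Proof.
move=> [Tlin Tcont].
pose TL := GRing.isLinear.Build K X Y *:%R T Tlin.
pose T' : {linear X -> Y} := HB.pack T TL.
have /linear_bounded_continuous/bounded_funP/(_ 1)[M TM] : continuous T' by [].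
exists (real_part M) => _ [x /= x1 <-].
have TxM : `|T x| <= M by apply: TM; rewrite -of_real1 -le_real_norm.
by rewrite le_real_norm real_partK// (le_trans _ TxM).
Qed.

Lemma le_opnorm (X Y : normedModType K) (T : X -> Y) (x : X) :
  bounded_operator T -> real_norm (T x) <= opnorm T * real_norm x.
Proof.
move=> Tb; have [Tlin _] := Tb.
have T0 : T 0 = 0.
  by apply: (addrI (T 0)); rewrite addr0 -{1}[T 0]scale1r -Tlin scale1r addr0.
have TZ (a : K) y : T (a *: y) = a *: T y by have := Tlin a y 0; rewrite !addr0 T0 addr0.
have [->|x0] := eqVneq x 0.
  by rewrite T0 !real_norm0 mulr0.
have nx0 : 0 < real_norm x by rewrite -(@ltr_of_real _ k) of_real0 real_normE normr_gt0.
have nxV : real_part `|(of_real (real_norm x))^-1 : K| = (real_norm x)^-1.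
  apply: (mulIf (lt0r_neq0 nx0)); rewrite mulVf ?lt0r_neq0//.
  rewrite -[LHS](@of_realK R k) of_realM real_partK// real_normE normfV normr_id.
  by rewrite mulVf ?normr_eq0// -of_real1 of_realK.
rewrite -ler_pdivrMr// mulrC -nxV -real_normZ -TZ.
apply: ub_le_sup; first exact: opnorm_has_ubound.
by exists ((of_real (real_norm x))^-1 *: x) => //=; rewrite real_normZ nxV mulVf ?lt0r_neq0.
Qed.

End operators.

(* The closed unit ball of the dual of Y. *)
Record dual_ball (R : realType) (k : scalar_kind)
    (Y : normedModType (scalars R k)) := DualBall {
  functional :> Y -> scalar_space R k;
  functional_bounded : bounded_operator functional;
  functional_norm_le1 : opnorm functional <= 1 }.

Lemma dual_ball_evaluation_bounded (R : realType) (k : scalar_kind)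
    (Y : normedModType (scalars R k)) (y : Y) :
  (fun f : dual_ball Y => f y) \in @bounded_scalar_fun R k (dual_ball Y).
Proof.
apply/bounded_scalar_funP; exists (real_norm y) => f.
apply: le_trans (le_opnorm _ (functional_bounded f)) _.
by rewrite ler_piMl ?real_norm_ge0 ?functional_norm_le1.
Qed.

Definition canonical_embedding (R : realType) (k : scalar_kind)
    (Y : normedModType (scalars R k)) (y : Y) : linfty R k (dual_ball Y) :=
  Linfty (dual_ball_evaluation_bounded y).

Definition operator_class (R : realType) (k : scalar_kind) :=
  forall X Y : banach R k, set (X -> Y).

Definition operator_qnorm (R : realType) (k : scalar_kind) :=
  forall X Y : banach R k, (X -> Y) -> R.

(* Pietsch's axioms, without completeness of the components.  Only the values of
   alpha on members of A are meaningful.  Homogeneity of alpha and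
   ||T|| <= alpha T, hence definiteness, follow from qnorm_id and qnorm_comp. *)
Record quasi_normed_ideal (R : realType) (k : scalar_kind)
    (A : operator_class R k) (alpha : operator_qnorm R k) : Prop := {
  ideal_bounded : forall (X Y : banach R k) (T : X -> Y),
    A X Y T -> bounded_operator T;
  ideal_id : A (scalar_space R k) (scalar_space R k) idfun;
  ideal_add : forall (X Y : banach R k) (S T : X -> Y),
    A X Y S -> A X Y T -> A X Y (S \+ T);
  ideal_comp : forall (W X Y Z : banach R k)
      (S : W -> X) (T : X -> Y) (U : Y -> Z),
    bounded_operator S -> A X Y T -> bounded_operator U ->
    A W Z (U \o T \o S);
  qnorm_ge0 : forall (X Y : banach R k) (T : X -> Y),
    A X Y T -> 0 <= alpha X Y T;
  qnorm_id : alpha (scalar_space R k) (scalar_space R k) idfun = 1;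
  qnorm_add : exists2 kappa : R, 1 <= kappa &
    forall (X Y : banach R k) (S T : X -> Y), A X Y S -> A X Y T ->
      alpha X Y (S \+ T) <= kappa * (alpha X Y S + alpha X Y T);
  qnorm_comp : forall (W X Y Z : banach R k)
      (S : W -> X) (T : X -> Y) (U : Y -> Z),
    bounded_operator S -> A X Y T -> bounded_operator U ->
    alpha W Z (U \o T \o S) <= opnorm U * alpha X Y T * opnorm S }.

Definition class_comp (R : realType) (k : scalar_kind)
    (A1 A2 : operator_class R k) : operator_class R k :=
  fun X Y => [set T | exists (Z : banach R k) (V : X -> Z) (U : Z -> Y),
    [/\ A2 X Z V, A1 Z Y U & T = U \o V]].

(* The usual quasi-norm of a product of ideals: the infimum of
   alpha1 U * alpha2 V over all admissible factorizations T = U \o V. *)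
Definition product_qnorm (R : realType) (k : scalar_kind)
    (A1 A2 : operator_class R k) (alpha1 alpha2 : operator_qnorm R k) :
    operator_qnorm R k :=
  fun X Y T => inf [set r | exists (Z : banach R k) (V : X -> Z) (U : Z -> Y),
    [/\ A2 X Z V, A1 Z Y U, T = U \o V & r = alpha1 Z Y U * alpha2 X Z V]].

(* canonical_embedding is the isometry i_Y of Y into l_oo(B_{Y^*}). *)
Definition injective_hull (R : realType) (k : scalar_kind)
    (A : operator_class R k) : operator_class R k :=
  fun X Y => [set T | bounded_operator T /\
    A X (linfty R k (dual_ball Y)) (@canonical_embedding R k Y \o T)].

Definition injective_class (R : realType) (k : scalar_kind)
    (A : operator_class R k) : Prop := injective_hull A = A.

(* Main.v *)
(* Let i_Y T = U V factor through Z, with V in A2 and U in A1. Since i_Y is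
   isometric and Y is complete, S = U^-1(i_Y(Y)) is a closed subspace of Z; it
   contains the range of V, and U restricted to S is i_Y W for a bounded
   W : S -> Y, so that W is in A1 by injectivity. The corestriction V0 : X -> S
   of V is in A2 by injectivity: the Hahn-Banach theorem, applied in each
   coordinate, extends i_S to E : Z -> l_oo(B_{S^*}), whence i_S V0 = E V. As
   i_Y is one-to-one, T = W V0.

   For the quasi-norm on the product ideal, a factorization U V can be rescaled
   so that both factors have quasi-norm at most sqrt c, for any c above the
   quasi-norm of the product; a sum is factored through the direct sum of the
   intermediate spaces, and (sqrt c + sqrt d)^2 <= 2 (c + d). *)

From HB Require Import structures.
Require Import Defs.
From mathcomp Require Import all_boot all_order all_algebra.
From mathcomp Require Import complex.
From mathcomp Require Import all_classical all_reals all_analysis.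
From mathcomp Require Import ring lra.

Set Implicit Arguments.
Unset Strict Implicit.
Unset Printing Implicit Defensive.

Import Order.TTheory GRing.Theory Num.Theory.
Import numFieldNormedType.Exports.

Local Open Scope classical_set_scope.
Local Open Scope ring_scope.

(** * The Hahn-Banach theorem *)

(** A partial linear map is encoded by its graph, so that extension is inclusion of sets and a chain
    of extensions has its union as upper bound. *)
Definition linear_relation (K : pzRingType) (E F : lmodType K)
    (G : set (E * F)) :=
  G (0, 0) /\
  forall a x y r s, G (x, r) -> G (y, s) -> G (a *: x + y, a *: r + s).

Section hahn_banach.
Context {R : realType} {V : lmodType R} (p : V -> R).
Hypothesis pD : forall x y, p (x + y) <= p x + p y.
Hypothesis pZ : forall (a : R) x, 0 <= a -> p (a *: x) = a * p x.

Definition dominated (G : set (V * R^o)) := forall x r, G (x, r) -> r <= p x.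

(** The value [c] at [v] must satisfy [r - p (x - v) <= c <= p (x + v) - r] for all [(x, r)] in [G].
    Subadditivity of [p] puts each lower bound below each upper bound, so the supremum of the lower
    bounds will do. *)
Lemma one_step_extension (G : set (V * R^o)) (v : V) :
  linear_relation G -> dominated G ->
  exists H : set (V * R^o), [/\ linear_relation H, dominated H, G `<=` H &
    exists c, H (v, c)].
Proof.
move=> [G0 GL] Gp.
have GZ a x r : G (x, r) -> G (a *: x, a *: r).
  by move=> /(GL a _ _ _ _)/(_ G0); rewrite !addr0.
pose L := [set xr.2 - p (xr.1 - v) | xr in G].
have Lub x r : G (x, r) -> ubound L (p (x + v) - r).
  move=> Gx _ [[y s] /= Gy <-].
  have /Gp := GL 1 _ _ _ _ Gx Gy; rewrite !scale1r => h.
  have := pD (x + v) (y - v); rewrite addrACA subrr addr0; lra.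
have Lsup : has_sup L.
  by split; [exists (0 - p (0 - v)), (0, 0)|exists (p (0 + v) - 0); exact: Lub].
pose c := sup L.
have cge x r : G (x, r) -> r - c <= p (x - v).
  move=> Gx; have : r - p (x - v) <= c by apply: ub_le_sup; [case: Lsup|exists (x, r)].
  by rewrite lerBlDr lerBlDl addrC.
have cle x r : G (x, r) -> r + c <= p (x + v).
  move=> Gx; have : c <= p (x + v) - r by apply: ge_sup; [case: Lsup|exact: Lub].
  lra.
exists [set ys | exists x r a, [/\ G (x, r), ys.1 = x + a *: v & ys.2 = r + a * c]].
split.
- split; first by exists 0, 0, 0; rewrite scale0r mul0r !addr0.
  move=> b _ _ _ _ [x [r [a [Gx /= -> ->]]]] [y [s [d [Gy /= -> ->]]]].
  exists (b *: x + y), (b *: r + s), (b * a + d); split; first exact: GL.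
    by rewrite /= scalerDl scalerDr scalerA addrACA.
  by rewrite /= mulrDl [b *: (_ + _)]mulrDr mulrA addrACA.
- move=> _ _ [x [r [a [Gx /= -> ->]]]].
  (* Dividing by the absolute value of [a] reduces the claim to [cge] when [a] is negative and to
     [cle] when it is positive. *)
  have [a0|a0|->] := ltgtP a 0; last by rewrite scale0r mul0r !addr0; exact: Gp.
  + have na : 0 < - a by rewrite oppr_gt0.
    have /cge := GZ (- a)^-1 _ _ Gx.
    rewrite -(ler_pM2l na) -pZ ?(ltW na)// scalerBr scalerA divff ?gt_eqF// scale1r.
    rewrite scaleNr opprK mulrBr [_^-1 *: r]/(_^-1 * r) mulrA divff ?gt_eqF//.
    by rewrite mul1r mulNr opprK.
  + have /cle := GZ a^-1 _ _ Gx.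
    rewrite -(ler_pM2l a0) -pZ ?(ltW a0)// scalerDr scalerA divff ?gt_eqF// scale1r.
    by rewrite mulrDr [_^-1 *: r]/(_^-1 * r) mulrA divff ?gt_eqF// mul1r.
- by move=> [x r] Gx; exists x, r, 0; rewrite scale0r mul0r !addr0.
- by exists c, 0, 0, 1; rewrite scale1r mul1r !add0r.
Qed.

(* The partial functional is given by its graph: a linear relation dominated by
   p is automatically single-valued, since r - s <= p 0 = 0. *)
Theorem hahn_banach (G : set (V * R^o)) :
  linear_relation G -> dominated G ->
  exists f : V -> R^o, [/\ linear f, forall x, f x <= p x &
    forall x r, G (x, r) -> f x = r].
Proof.
move=> [G0 GL] Gp.
(* The union with [G] is built into [good] because Zorn's lemma also asks about the empty chain,
   whose union is empty. *)
pose good H := linear_relation (G `|` H) /\ dominated (G `|` H).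
have [F FP Ftot|A [[AL Ap] Amax]] := @Zorn_bigcup _ good.
  (* Linearity involves two points at a time. Any two points of the union already lie in [G]
     together with a single member of the chain, or in [G] alone, which is the case [X = set0]. *)
  have chain u w : (G `|` \bigcup_(X in F) X) u -> (G `|` \bigcup_(X in F) X) w ->
      exists2 X, good X & X `<=` \bigcup_(X in F) X /\ (G `|` X) u /\ (G `|` X) w.
    have good0 : good set0 by rewrite /good setU0.
    case=> [Gu|[X FX Xu]] [Gw|[Y FY Yw]].
    - by exists set0 => //; split; [|split; left].
    - by exists Y; [exact: FP|split; [exact: bigcup_sup|split; [left|right]]].
    - by exists X; [exact: FP|split; [exact: bigcup_sup|split; [right|left]]].
    - have [XY|YX] := Ftot _ _ FX FY.
      + exists Y; [exact: FP|split; [exact: bigcup_sup|split; right => //]].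
        exact: XY.
      + exists X; [exact: FP|split; [exact: bigcup_sup|split; right => //]].
        exact: YX.
  split; first split; first by left.
    move=> a x y r s xr ys.
    have [X [[_ XL] _] [XF [Xx Xy]]] := chain _ _ xr ys.
    by have [] := XL a _ _ _ _ Xx Xy; [left|move=> /XF; right].
  move=> x r xr; have [X [_ Xp] [_ [Xx _]]] := chain _ _ xr xr.
  exact: Xp.
have Atotal x : exists r, (G `|` A) (x, r).
  apply: contrapT => nA.
  have [H [HL Hp GAH [c Hc]]] := one_step_extension x AL Ap.
  have GH : G `|` H = H by apply/setUidPr => u Gu; apply: GAH; left.
  apply: (Amax H); last by split; rewrite GH.
  rewrite properEneq; split; last by move=> u Au; apply: GAH; right.
  by apply/eqP => AH; apply: nA; exists c; right; rewrite AH.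
have [f fA] := choice Atotal.
have [_ AL'] := AL.
have Afun x r : (G `|` A) (x, r) -> f x = r.
  have p0 : p 0 = 0 by have := pZ 0 (lexx 0); rewrite scale0r mul0r.
  move=> Ax; apply/eqP; rewrite eq_le -subr_le0 -[X in _ && X]subr_le0 -p0.
  have sub y s t : (G `|` A) (y, s) -> (G `|` A) (y, t) -> s - t <= p 0.
    move=> As At; apply: Ap; have := AL' (-1) _ _ _ _ At As.
    by rewrite !scaleN1r addNr addrC.
  by rewrite !(sub x).
exists f; split=> [a x y|x|x r Gx]; [|exact: Ap|by apply: Afun; left].
by apply: Afun; exact: AL'.
Qed.

End hahn_banach.

(** A synonym of [V] that can carry the real scalar multiplication without clashing with the complex
    one. *)
Definition real_restriction (R : realType) (V : lmodType R[i]%C) : Type := V.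

Section real_restriction.
Context {R : realType} {V : lmodType R[i]%C}.

HB.instance Definition _ := GRing.Zmodule.on (real_restriction V).

Let scale (a : R) (x : real_restriction V) : real_restriction V :=
  (a%:C)%C *: (x : V).

Fact real_scaleA a b x : scale a (scale b x) = scale (a * b) x.
Proof. by rewrite /scale scalerA -rmorphM. Qed.

Fact real_scale1 : left_id 1 scale.
Proof. by move=> x; rewrite /scale scale1r. Qed.

Fact real_scaleDr : right_distributive scale +%R.
Proof. by move=> a x y; rewrite /scale scalerDr. Qed.

Fact real_scaleDl x : {morph scale^~ x : a b / a + b}.
Proof. by move=> a b; rewrite /scale rmorphD scalerDl. Qed.

HB.instance Definition _ := GRing.Zmodule_isLmodule.Build R
  (real_restriction V) real_scaleA real_scale1 real_scaleDr real_scaleDl.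

Lemma real_restriction_scaleE (a : R) (x : real_restriction V) :
  a *: x = (a%:C)%C *: (x : V).
Proof. by []. Qed.

End real_restriction.

Section complex_hahn_banach.
Context {R : realType} {V : lmodType R[i]%C} (p : V -> R).
Hypothesis pD : forall x y, p (x + y) <= p x + p y.
Hypothesis pZ : forall (a : R[i]%C) x,
  ((p (a *: x))%:C)%C = `|a| * ((p x)%:C)%C.

(** The real theorem extends the real parts to some [f]. The only complex-linear functional with
    real part [f] is [f x - i f (i x)], and this is [F]. *)
Theorem complex_hahn_banach (G : set (V * (R[i]%C)^o)) :
  linear_relation G -> (forall x c, G (x, c) -> `|c| <= ((p x)%:C)%C) ->
  exists F : V -> (R[i]%C)^o, [/\ linear F,
    forall x, `|F x| <= ((p x)%:C)%C & forall x c, G (x, c) -> F x = c].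
Proof.
move=> [G0 GL] Gle.
pose GR : set (real_restriction V * R^o) :=
  [set xr | exists2 c : R[i]%C, G (xr.1, c) & xr.2 = complex.Re c].
have [||||f [fL fp fG]] := @hahn_banach R (real_restriction V) p _ _ GR.
- exact: pD.
- move=> a x a0; apply: complexI; rewrite [RHS]rmorphM/= real_restriction_scaleE.
  by rewrite pZ ger0_norm ?lecR.
- split; first by exists 0.
  move=> a x y _ _ [c /= Gc ->] [d /= Gd ->].
  exists ((a%:C)%C * c + d); first exact: GL.
  by case: (c) (d) => [? ?] [? ?] /=; rewrite mul0r subr0.
- move=> x _ [c /= /Gle cx ->].
  rewrite -lecR; apply: le_trans cx; apply: le_trans (normc_ge_Re c).
  by rewrite lecR ler_norm.
have fD (x y : V) : f (x + y) = f x + f y.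
  by have := fL 1 x y; rewrite !scale1r.
have fZ (a : R) (x : V) : f ((a%:C)%C *: x) = a * f x.
  have f0 : f 0 = 0 by apply: (addrI (f 0)); rewrite -fD !addr0.
  by have := fL a x 0; rewrite f0 !addr0.
pose F (x : V) : (R[i]%C)^o := (f x +i* - f ('i%C *: x))%C.
have FZ (a : R[i]%C) (x : V) : F (a *: x) = a * F x.
  case: a => a b.
  have abE : (a +i* b)%C = (a%:C)%C + (b%:C)%C * 'i%C.
    by rewrite mulrC; exact: (complexE (a +i* b)%C).
  have iabE : 'i%C * (a +i* b)%C = ((- b)%:C)%C + (a%:C)%C * 'i%C.
    by apply/eqP; rewrite eq_complex /=; apply/andP; split; apply/eqP; ring.
  rewrite /F scalerA iabE abE !scalerDl -!scalerA !fD !fZ.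
  by apply/eqP; rewrite eq_complex /=; apply/andP; split; apply/eqP; ring.
have FD (x y : V) : F (x + y) = F x + F y.
  by rewrite /F scalerDr !fD opprD.
exists F; split=> [a x y|x|x c Gc]; first by rewrite FD FZ.
- have [Fx0|Fx0] := eqVneq (F x) 0.
    have /= fx0 : complex.Re (F x) = 0 by rewrite Fx0.
    by rewrite Fx0 normr0 lecR -fx0; exact: fp.
  (* Rotate x so that F takes a nonnegative real value there. *)
  pose t : R[i]%C := `|F x| / F x.
  have Ft : F (t *: x) = `|F x| by rewrite FZ /t divfK.
  have -> : ((p x)%:C)%C = ((p (t *: x))%:C)%C.
    by rewrite pZ /t normrM normfV normr_id divff ?mul1r ?normr_eq0.
  rewrite -Ft.
  have -> : F (t *: x) = ((f (t *: x))%:C)%C.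
    have : 0 <= F (t *: x) by rewrite Ft.
    by rewrite /F lecE /= => /andP[/eqP -> _].
  by rewrite lecR; exact: fp.
- rewrite /F (fG x (complex.Re c)); last by exists c.
  rewrite (fG _ (complex.Re ('i%C * c))); last first.
    by exists ('i%C * c) => //=; have := GL 'i%C _ _ _ _ Gc G0; rewrite !addr0.
  by case: c {Gc} => a b /=; rewrite mul0r mul1r sub0r opprK.
Qed.

End complex_hahn_banach.

(** * Extension of functionals dominated by the norm, over both scalar fields *)

Section normed_hahn_banach.
Context {R : realType}.

Lemma real_normed_hahn_banach (V : normedModType (scalars R RealScalars))
    (G : set (V * scalar_space R RealScalars)) :
  linear_relation G -> (forall x c, G (x, c) -> `|c| <= `|x|) ->
  exists F : V -> scalar_space R RealScalars,
    [/\ linear F, forall x, `|F x| <= `|x| & forall x c, G (x, c) -> F x = c].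
Proof.
move=> GL Gle.
have [|||F [FL Fp FG]] := @hahn_banach R V (fun x : V => `|x| : R) _ _ G GL.
- by move=> x y; exact: ler_normD.
- by move=> a x a0; rewrite normrZ ger0_norm.
- by move=> x r /Gle; apply: le_trans; exact: ler_norm.
exists F; split=> // x.
have F0 : F 0 = 0.
  by apply: (addrI (F 0)); rewrite addr0 -{1}[F 0]scale1r -FL scale1r addr0.
(* Domination at [x] bounds [F x] from above; domination at [- x] bounds it from below. *)
rewrite [`|F x|]/(`|F x : R|) ler_norml Fp andbT lerNl.
have := Fp (- x); rewrite normrN; apply: le_trans.
by have := FL (-1) x 0; rewrite !addr0 F0 !scaleN1r addr0 => ->.
Qed.

Lemma complex_normed_hahn_banach (V : normedModType (scalars R ComplexScalars))
    (G : set (V * scalar_space R ComplexScalars)) :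
  linear_relation G -> (forall x c, G (x, c) -> `|c| <= `|x|) ->
  exists F : V -> scalar_space R ComplexScalars,
    [/\ linear F, forall x, `|F x| <= `|x| & forall x c, G (x, c) -> F x = c].
Proof.
move=> GL Gle.
have nE (x : V) : ((real_norm x)%:C)%C = `|x| :> R[i]%C := real_normE x.
have [|||F [FL Fp FG]] :=
  @complex_hahn_banach R V (fun x => real_norm x) _ _ G GL.
- by move=> x y; exact: real_normD.
- by move=> a x; rewrite !nE; exact: (@normrZ (scalars R ComplexScalars) V).
- by move=> x c; rewrite nE; exact: Gle.
by exists F; split=> // x; have := Fp x; rewrite nE.
Qed.

Theorem normed_hahn_banach (k : scalar_kind) (V : normedModType (scalars R k))
    (G : set (V * scalar_space R k)) :
  linear_relation G -> (forall x c, G (x, c) -> `|c| <= `|x|) ->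
  exists F : V -> scalar_space R k,
    [/\ linear F, forall x, `|F x| <= `|x| & forall x c, G (x, c) -> F x = c].
Proof.
case: k V G; [exact: real_normed_hahn_banach|exact: complex_normed_hahn_banach].
Qed.

End normed_hahn_banach.

(** * Products and closed subspaces of Banach spaces *)

(* The library does not provide the join of the pointed and uniform structures
   of a product. *)
HB.saturate prod.

Lemma prod_complete (K : numFieldType) (X Y : completeNormedModType K)
    (F : set_system (X * Y)) :
  ProperFilter F -> cauchy F -> cvg F.
Proof.
move=> FF /cauchyP Fc.
have /cvg_ex[x Fx] : cvg (fst @ F).
  apply: cauchy_cvg; apply/cauchyP => e /Fc[[x y] Fxy].
  by exists x; rewrite /nbhs/=; apply: filterS Fxy => -[? ?] [].
have /cvg_ex[y Fy] : cvg (snd @ F).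
  apply: cauchy_cvg; apply/cauchyP => e /Fc[[x' y] Fxy].
  by exists y; rewrite /nbhs/=; apply: filterS Fxy => -[? ?] [].
apply/cvg_ex; exists (x, y); apply: cvg_trans (cvg_pair Fx Fy).
by move=> A; rewrite /nbhs/=; apply: filterS => -[].
Qed.

HB.instance Definition _ (K : numFieldType) (X Y : completeNormedModType K) :=
  Uniform_isComplete.Build (X * Y)%type (@prod_complete K X Y).

(** The closedness proof is packed with the carrier so that completeness of [submodule] can be
    registered as an instance. *)
Record closed_submodule (K : numFieldType) (Z : normedModType K) :=
  ClosedSubmodule {
    carrier : {pred Z};
    carrier_submod : submod_closed carrier;
    carrier_closed : closed [set x | x \in carrier] }.

Section closed_submodule.
Context {K : numFieldType} {Z : completeNormedModType K}.
Variable S : closed_submodule Z.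

HB.instance Definition _ :=
  GRing.isSubmodClosed.Build K Z (carrier S) (carrier_submod S).

Record submodule := Submodule {
  submodule_val :> Z;
  submodule_valP : submodule_val \in carrier S }.

HB.instance Definition _ := [isSub for submodule_val].
HB.instance Definition _ := [Choice of submodule by <:].
HB.instance Definition _ := [SubChoice_isSubLmodule of submodule by <:].

Let subnorm (x : submodule) : K := `|submodule_val x|.

Fact submodule_normD x y : subnorm (x + y) <= subnorm x + subnorm y.
Proof. exact: ler_normD. Qed.

Fact submodule_normZ (a : K) x : subnorm (a *: x) = `|a| * subnorm x.
Proof. exact: normrZ. Qed.

Fact submodule_norm_eq0 x : subnorm x = 0 -> x = 0.
Proof. by move=> /normr0_eq0 x0; exact: val_inj. Qed.

HB.instance Definition _ := Lmodule_isNormed.Build K submodule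
  submodule_normD submodule_normZ submodule_norm_eq0.

Lemma submodule_complete (F : set_system submodule) :
  ProperFilter F -> cauchy F -> cvg F.
Proof.
move=> FF /cauchyP Fc.
have /cvg_ex[z Fz] : cvg (submodule_val @ F).
  apply: cauchy_cvg; apply/cauchyP => e /Fc[x Fx].
  exists (submodule_val x); rewrite /nbhs/=; apply: filterS Fx => y.
  by rewrite -!ball_normE.
have zS : z \in carrier S.
  apply: (closed_cvg _ (@carrier_closed K Z S) _ z Fz).
  by near=> y; exact: submodule_valP.
apply/cvg_ex; exists (Submodule zS); apply/cvgrPdist_lt => e e0.
by move/cvgrPdist_lt: Fz => /(_ e e0).
Unshelve. all: by end_near. Qed.

HB.instance Definition _ := Uniform_isComplete.Build submodule submodule_complete.

End closed_submodule.

(** * Bounded operators *)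

Section bounded_operators.
Context {R : realType} {k : scalar_kind}.
Local Notation K := (scalars R k).

Section linear_facts.
Context {X Y : normedModType K} (T : X -> Y).
Hypothesis Tlin : linear T.

Lemma operator0 : T 0 = 0.
Proof. by apply: (addrI (T 0)); rewrite addr0 -{1}[T 0]scale1r -Tlin scale1r addr0. Qed.

Lemma operatorD x y : T (x + y) = T x + T y.
Proof. by have := Tlin 1 x y; rewrite !scale1r. Qed.

Lemma operatorZ a x : T (a *: x) = a *: T x.
Proof. by have := Tlin a x 0; rewrite operator0 !addr0. Qed.

Lemma operatorB x y : T (x - y) = T x - T y.
Proof. by rewrite operatorD -scaleN1r operatorZ scaleN1r. Qed.

Lemma bounded_operator_le (M : R) :
  (forall x, real_norm (T x) <= M * real_norm x) -> bounded_operator T.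
Proof.
move=> TM; split=> //.
(* [M] has no sign hypothesis; its absolute value gives a bound that is monotone in the norm of
   [x]. *)
have TM' x : `|T x| <= `|of_real M : K| * `|x|.
  rewrite -[`|T x|]real_normE -[`|x|]real_normE -[`|of_real M : K|]real_partK//.
  rewrite -of_realM ler_of_real.
  apply: le_trans (TM x) _; rewrite ler_wpM2r ?real_norm_ge0//.
  rewrite -(@ler_of_real R k) real_partK//; apply: real_ler_norm.
  by rewrite realE -of_real0 !ler_of_real le_total.
pose TL := GRing.isLinear.Build K X Y *:%R T Tlin.
pose T' : {linear X -> Y} := HB.pack T TL.
suff : continuous T' by [].
apply/linear_bounded_continuous/bounded_funP => r.
exists (`|of_real M : K| * r) => x xr.
by apply: le_trans (TM' x) _; rewrite ler_wpM2l.
Qed.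

Lemma opnorm_le (M : R) : 0 <= M ->
  (forall x, real_norm (T x) <= M * real_norm x) -> opnorm T <= M.
Proof.
move=> M0 TM; apply: ge_sup.
  by exists (real_norm (T 0)), 0 => //=; rewrite real_norm0.
by move=> _ [x /= x1 <-]; rewrite (le_trans (TM x))// ler_piMr.
Qed.

End linear_facts.

Lemma opnorm_ge0 (X Y : normedModType K) (T : X -> Y) :
  bounded_operator T -> 0 <= opnorm T.
Proof.
move=> /opnorm_has_ubound Tb; apply: le_trans (real_norm_ge0 (T 0)) _.
by apply: ub_le_sup => //; exists 0 => //=; rewrite real_norm0.
Qed.

Lemma bounded_operator_comp (X Y Z : normedModType K) (T : X -> Y) (U : Y -> Z) :
  bounded_operator T -> bounded_operator U -> bounded_operator (U \o T).
Proof.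
move=> [TL Tc] [UL Uc]; split; first by move=> a x y /=; rewrite TL UL.
by move=> x; apply: continuous_comp; [exact: Tc|exact: Uc].
Qed.

Lemma contraction_bounded (X Y : normedModType K) (T : X -> Y) : linear T ->
  (forall x, `|T x| <= `|x|) -> bounded_operator T /\ opnorm T <= 1.
Proof.
move=> TL T1.
have T1' x : real_norm (T x) <= 1 * real_norm x.
  by rewrite mul1r le_real_norm real_normE.
by split; [exact: bounded_operator_le T1'|exact: opnorm_le].
Qed.

(** Only an inequality, since the identity of the zero space has operator norm 0. *)
Lemma idfun_bounded (X : normedModType K) :
  bounded_operator (@idfun X) /\ opnorm (@idfun X) <= 1.
Proof. exact: contraction_bounded. Qed.

Lemma scale_bounded (X : normedModType K) (t : R) : 0 <= t ->
  bounded_operator (fun x : X => of_real t *: x) /\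
  opnorm (fun x : X => of_real t *: x) <= t.
Proof.
move=> t0.
have tL : linear (fun x : X => of_real t *: x : X).
  by move=> a x y; rewrite scalerDr !scalerA mulrC.
have tle (x : X) : real_norm (of_real t *: x) <= t * real_norm x.
  by rewrite real_normZ ger0_norm ?of_realK// -of_real0 ler_of_real.
by split; [exact: bounded_operator_le tle|exact: opnorm_le].
Qed.

Lemma line_bounded (X : normedModType K) (x : X) :
  bounded_operator (fun a : scalar_space R k => a *: x) /\
  opnorm (fun a : scalar_space R k => a *: x) <= real_norm x.
Proof.
have xL : linear (fun a : scalar_space R k => a *: x : X).
  by move=> a b c; rewrite scalerDl scalerA.
have xle (a : scalar_space R k) : real_norm (a *: x) <= real_norm x * real_norm a.
  by rewrite real_normZ mulrC.
by split; [exact: bounded_operator_le xle|exact: opnorm_le (real_norm_ge0 x) xle].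
Qed.

(** The product carries the maximum norm, which makes the projections and injections below
    contractions. The order of the complex scalars is partial, so comparability of the two norms is
    supplied by their being real. *)
Lemma prod_norm_le (X Y : normedModType K) (z : X * Y) (c : K) :
  (`|z| <= c) = (`|z.1| <= c) && (`|z.2| <= c).
Proof. by rewrite prod_normE comparable_ge_max// real_comparable. Qed.

Lemma fst_bounded (X Y : normedModType K) :
  bounded_operator (@fst X Y) /\ opnorm (@fst X Y) <= 1.
Proof.
apply: contraction_bounded => [//|z].
by have := lexx `|z|; rewrite prod_norm_le => /andP[].
Qed.

Lemma snd_bounded (X Y : normedModType K) :
  bounded_operator (@snd X Y) /\ opnorm (@snd X Y) <= 1.
Proof.
apply: contraction_bounded => [//|z].
by have := lexx `|z|; rewrite prod_norm_le => /andP[].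
Qed.

Lemma pairx0_bounded (X Y : normedModType K) :
  bounded_operator (fun x : X => (x, 0 : Y)) /\
  opnorm (fun x : X => (x, 0 : Y)) <= 1.
Proof.
apply: contraction_bounded => [a x y|x].
  by congr pair => /=; rewrite scaler0 addr0.
by rewrite prod_norm_le /= lexx normr0 normr_ge0.
Qed.

Lemma pair0x_bounded (X Y : normedModType K) :
  bounded_operator (fun y : Y => (0 : X, y)) /\
  opnorm (fun y : Y => (0 : X, y)) <= 1.
Proof.
apply: contraction_bounded => [a x y|x].
  by congr pair => /=; rewrite scaler0 addr0.
by rewrite prod_norm_le /= lexx normr0 normr_ge0.
Qed.

End bounded_operators.

(** * The canonical embedding *)

Section canonical_embedding.
Context {R : realType} {k : scalar_kind}.
Local Notation K := (scalars R k).
Local Notation K1 := (scalar_space R k).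

Lemma canonical_embedding_linear (Y : normedModType K) :
  linear (@canonical_embedding R k Y).
Proof.
move=> a x y; apply/val_inj/funext => f /=.
by have [fL _] := functional_bounded f; exact: fL.
Qed.

(** Hahn-Banach applied to [a *: y |-> a * |y|] on the line through [y]. For [y = 0] this graph is
    just the origin, so no case distinction arises. *)
Lemma norming_functional (Y : normedModType K) (y : Y) :
  exists f : dual_ball Y, f y = `|y|.
Proof.
pose G : set (Y * K1) := [set z | exists a : K, z = (a *: y, a * `|y|)].
have [||F [FL F1 FG]] := @normed_hahn_banach R k Y G.
- split; first by exists 0; rewrite scale0r mul0r.
  move=> a _ _ _ _ [b [-> ->]] [c [-> ->]]; exists (a * b + c).
  by rewrite scalerDl scalerA mulrDl -mulrA.
- by move=> _ _ [a [-> ->]]; rewrite normrM normr_id normrZ.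
have [Fb Fn] := contraction_bounded FL F1.
by exists (DualBall Fb Fn); apply: FG; exists 1; rewrite scale1r mul1r.
Qed.

Lemma dual_ball_le (Y : normedModType K) (f : dual_ball Y) y : `|f y| <= `|y|.
Proof.
rewrite -[`|f y|]real_normE -[`|y|]real_normE ler_of_real.
apply: le_trans (le_opnorm _ (functional_bounded f)) _.
by rewrite ler_piMl ?real_norm_ge0 ?functional_norm_le1.
Qed.

Lemma canonical_embedding_norm (Y : normedModType K) (y : Y) :
  `|canonical_embedding y| = `|y|.
Proof.
apply/eqP; rewrite eq_le; apply/andP; split.
  by apply: linfty_norm_le => // f; exact: dual_ball_le.
have [f fy] := norming_functional y.
have := linfty_norm_ge (canonical_embedding y) f.
by rewrite [X in `|X|]fy normr_id.
Qed.

Lemma canonical_embedding_bounded (Y : normedModType K) :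
  bounded_operator (@canonical_embedding R k Y).
Proof.
have [x|//] := contraction_bounded (@canonical_embedding_linear Y).
by rewrite canonical_embedding_norm.
Qed.

Lemma canonical_embedding_inj (Y : normedModType K) :
  injective (@canonical_embedding R k Y).
Proof.
move=> x y xy; apply/eqP; rewrite -subr_eq0 -normr_eq0 -canonical_embedding_norm.
by rewrite (operatorB (@canonical_embedding_linear Y)) xy subrr normr0.
Qed.

(** The neighbourhoods of a point [g] of the closure are pulled back along [T]. The resulting filter
    is proper because each neighbourhood meets the range, and Cauchy because [T] is isometric; by
    continuity and uniqueness of limits, [T] sends its limit to [g]. *)
Lemma isometry_closed_range (Y : banach R k) (W : normedModType K) (T : Y -> W) :
  bounded_operator T -> (forall y, `|T y| = `|y|) -> closed (range T).
Proof.
move=> [TL Tc] Tiso g gT.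
pose F := filter_from (nbhs g) (fun B => T @^-1` B).
have FF : ProperFilter F.
  apply: filter_from_proper; last first.
    by move=> B /gT[_ [[y _ <-] By]]; exists y.
  apply: filter_from_filter; first by exists setT; exact: filterT.
  by move=> A B gA gB; exists (A `&` B) => //; exact: filterI.
have TF : T @ F --> g by move=> B gB; exists B.
have /cvg_ex[y Fy] : cvg F.
  apply: cauchy_cvg; apply/cauchyP => e e0.
  have e20 : 0 < e / 2 by rewrite divr_gt0.
  have gB := nbhsx_ballx g _ e20.
  have [_ [[y _ <-] gy]] := gT _ gB.
  exists y; exists (ball g (e / 2)) => // z gz.
  rewrite -ball_normE /= -Tiso (operatorB TL).
  move: gy gz; rewrite -ball_normE /= => gy gz.
  by apply: (distm_lt_split (z := g)); rewrite // distrC.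
exists y => //; apply: (@cvg_unique _ (@norm_hausdorff _ W) (T @ F)) => //.
by move=> B /Tc; exact: Fy.
Qed.

(* Coordinatewise Hahn-Banach: l_oo spaces are injective Banach spaces. *)
Lemma canonical_embedding_extension (Z : banach R k) (S : closed_submodule Z) :
  exists2 E : Z -> linfty R k (dual_ball (submodule S)), bounded_operator E &
    forall x : submodule S, E (submodule_val x) = canonical_embedding x.
Proof.
have ext (f : dual_ball (submodule S)) : exists F : Z -> K1, [/\ linear F,
    forall z, `|F z| <= `|z| & forall x : submodule S, F (submodule_val x) = f x].
  pose G : set (Z * K1) := [set zc | exists x, zc = (submodule_val x, f x)].
  have [fL _] := functional_bounded f.
  have [||F [FL F1 FG]] := @normed_hahn_banach R k Z G.
  - split; first by exists 0; rewrite (operator0 fL).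
    by move=> a _ _ _ _ [x [-> ->]] [y [-> ->]]; exists (a *: x + y); rewrite fL.
  - by move=> _ _ [x [-> ->]]; exact: dual_ball_le.
  by exists F; split=> // x; apply: FG; exists x.
have [F FP] := choice ext.
have Fb z : (fun f => F f z) \in @bounded_scalar_fun R k (dual_ball (submodule S)).
  apply/bounded_scalar_funP; exists (real_norm z) => f.
  by have [_ F1 _] := FP f; rewrite le_real_norm real_normE.
pose E (z : Z) : linfty R k (dual_ball (submodule S)) := Linfty (Fb z).
have EL : linear E.
  by move=> a x y; apply/val_inj/funext => f /=; have [FL _ _] := FP f; exact: FL.
have E1 z : `|E z| <= `|z|.
  by apply: linfty_norm_le => // f; have [_ F1 _] := FP f; exact: F1.
have [Eb _] := contraction_bounded EL E1.
exists E => //.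
by move=> x; apply/val_inj/funext => f /=; have [_ _ ->] := FP f.
Qed.

End canonical_embedding.

(** * Products of operator ideals *)

Section ideal_theory.
Context {R : realType} {k : scalar_kind}.
Local Notation K1 := (scalar_space R k).
Context {A : operator_class R k} {alpha : operator_qnorm R k}.
Hypothesis I : quasi_normed_ideal A alpha.

Lemma ideal_compl (X Y Z : banach R k) (T : X -> Y) (U : Y -> Z) :
  A T -> bounded_operator U -> A (U \o T).
Proof. by move=> AT Ub; exact: (ideal_comp I (idfun_bounded X).1 AT Ub). Qed.

Lemma ideal_compr (W X Y : banach R k) (S : W -> X) (T : X -> Y) :
  A T -> bounded_operator S -> A (T \o S).
Proof. by move=> AT Sb; exact: (ideal_comp I Sb AT (idfun_bounded Y).1). Qed.

Lemma qnorm_compl (X Y Z : banach R k) (T : X -> Y) (U : Y -> Z) (b : R) :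
  A T -> bounded_operator U -> opnorm U <= b -> alpha (U \o T) <= b * alpha T.
Proof.
move=> AT Ub Ule; have [idb id1] := idfun_bounded X.
apply: le_trans (qnorm_comp I idb AT Ub) _.
have a0 := qnorm_ge0 I AT; have U0 := opnorm_ge0 Ub.
apply: le_trans (_ : opnorm U * alpha T <= _); last by rewrite ler_wpM2r.
by rewrite ler_piMr ?mulr_ge0.
Qed.

Lemma qnorm_compr (W X Y : banach R k) (S : W -> X) (T : X -> Y) (c : R) :
  A T -> bounded_operator S -> opnorm S <= c -> alpha (T \o S) <= alpha T * c.
Proof.
move=> AT Sb Sle; have [idb id1] := idfun_bounded Y.
apply: le_trans (qnorm_comp I Sb AT idb) _.
have a0 := qnorm_ge0 I AT; have S0 := opnorm_ge0 Sb.
apply: le_trans (_ : alpha T * opnorm S <= _); last by rewrite ler_wpM2l.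
by rewrite ler_wpM2r// ler_piMl.
Qed.

(** If [U z] is nonzero, the identity of the scalars is [a |-> a *: z], then [U], then
    multiplication by the inverse of [U z]. Since the identity has quasi-norm 1, this gives
    [1 <= |U z|^-1 * alpha U * |z|]. The lemma yields the normalization of the product quasi-norm at
    the identity. *)
Lemma opnorm_functional_le (Z : banach R k) (U : Z -> K1) :
  A U -> opnorm U <= alpha U.
Proof.
move=> AU; have Ub := ideal_bounded I AU.
have [UL _] := Ub; have a0 := qnorm_ge0 I AU.
apply: opnorm_le => // z.
have [Uz0|Uz0] := eqVneq (U z) 0.
  by rewrite Uz0 real_norm0 mulr_ge0 ?real_norm_ge0.
have [zb zn] := line_bounded z.
have [sb sn] := line_bounded ((U z)^-1 : K1).
have AUz := ideal_compr AU zb.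
have := qnorm_compl AUz sb sn.
have -> : (fun a : K1 => a *: ((U z)^-1 : K1)) \o (U \o (fun a : K1 => a *: z))
    = idfun.
  apply/funext => a /=; rewrite (operatorZ UL).
  exact: (mulfK Uz0 (a : scalars R k)).
have := ler_wpM2l (real_norm_ge0 ((U z)^-1 : K1)) (qnorm_compr AU zb zn).
rewrite (qnorm_id I) => /[swap] /le_trans/[apply].
have Uzn : 0 < real_norm (U z).
  by rewrite -(@ltr_of_real _ k) of_real0 real_normE normr_gt0.
rewrite -(ler_pM2l Uzn) mulr1 => /le_trans; apply.
rewrite mulrA (_ : real_norm (U z) * _ = 1) ?mul1r//.
apply: (can_inj (@of_realK R k)).
by rewrite of_realM !real_normE of_real1 normfV divff ?normr_eq0.
Qed.

End ideal_theory.

Lemma balance (R : realType) (a b c : R) : 0 <= a -> 0 <= b -> a * b < c ->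
  exists2 t, 0 < t & t * a <= Num.sqrt c /\ t^-1 * b <= Num.sqrt c.
Proof.
move=> a0 b0 abc.
have c0 : 0 < c by apply: le_lt_trans abc; rewrite mulr_ge0.
have s0 : 0 < Num.sqrt c by rewrite sqrtr_gt0.
have [->|an0] := eqVneq a 0.
  (* Here only the second bound constrains [t]; [b + 1] in place of [b] keeps [t] positive when
     [b = 0]. *)
  exists ((b + 1) / Num.sqrt c); first by rewrite divr_gt0// ltr_wpDl.
  rewrite mulr0 ltW//; split=> //.
  rewrite invfM invrK mulrAC ler_piMl ?(ltW s0)//.
  by rewrite ler_pdivrMl ?ltr_wpDl// mulr1 lerDl.
have ap : 0 < a by rewrite lt_def an0.
(* This makes [t * a] equal to [sqrt c], and [t^-1 * b = a * b / sqrt c] is then at most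
   [sqrt c]. *)
exists (Num.sqrt c / a); first by rewrite divr_gt0.
rewrite divfK//; split=> //.
rewrite invfM invrK -mulrA ler_pdivrMl// -expr2 sqr_sqrtr ?(ltW c0)//.
by rewrite mulrC in abc *; exact: ltW.
Qed.

(** Used to take the operator norms of the outer maps out of the infimum in the product quasi-norm.
    When [n = 0] division is impossible, and a single element of [E] gives the claim. *)
Lemma le_mul_inf (R : realType) (E : set R) (n x : R) : 0 <= n -> E !=set0 ->
  (forall r, E r -> x <= n * r) -> x <= n * inf E.
Proof.
rewrite le_eqVlt => /predU1P[<-|n0] [r Er] nE; first by have := nE _ Er; rewrite !mul0r.
rewrite -ler_pdivrMl//; apply: lb_le_inf; first by exists r.
by move=> s Es; rewrite /= ler_pdivrMl//; exact: nE.
Qed.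

Section product_ideal.
Context {R : realType} {k : scalar_kind}.
Context {A1 A2 : operator_class R k} {alpha1 alpha2 : operator_qnorm R k}.
Hypothesis I1 : quasi_normed_ideal A1 alpha1.
Hypothesis I2 : quasi_normed_ideal A2 alpha2.
Local Notation K1 := (scalar_space R k).
Local Notation AA := (class_comp A1 A2).
Local Notation qn := (product_qnorm A1 A2 alpha1 alpha2).

Lemma product_qnorm_lbound (X Y : banach R k) (T : X -> Y) :
  lbound [set r | exists (Z : banach R k) (V : X -> Z) (U : Z -> Y),
    [/\ A2 V, A1 U, T = U \o V & r = alpha1 U * alpha2 V]] 0.
Proof.
by move=> _ [Z [V [U [AV AU _ ->]]]]; rewrite mulr_ge0 ?(qnorm_ge0 I1) ?(qnorm_ge0 I2).
Qed.

Lemma product_qnorm_ge0 (X Y : banach R k) (T : X -> Y) : AA T -> 0 <= qn T.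
Proof.
move=> [Z [V [U [AV AU TE]]]]; apply: lb_le_inf; last exact: product_qnorm_lbound.
by exists (alpha1 U * alpha2 V), Z, V, U.
Qed.

Lemma product_qnorm_le (X Y Z : banach R k) (V : X -> Z) (U : Z -> Y) :
  A2 V -> A1 U -> qn (U \o V) <= alpha1 U * alpha2 V.
Proof.
move=> AV AU; apply: ge_inf; last by exists Z, V, U.
by exists 0; exact: product_qnorm_lbound.
Qed.

(** The infimum need not be attained, whence the strict bound by [c]. The scalars [t] and [t^-1] of
    [balance] enter as multiplication operators; they cancel in the composite by linearity of
    [U]. *)
Lemma balanced_factorization (X Y : banach R k) (T : X -> Y) (c : R) :
  AA T -> qn T < c ->
  exists (Z : banach R k) (V : X -> Z) (U : Z -> Y), [/\ A2 V, A1 U, T = U \o V,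
    alpha1 U <= Num.sqrt c & alpha2 V <= Num.sqrt c].
Proof.
move=> [Z0 [V0 [U0 [AV0 AU0 T0]]]] /inf_lt[|_ [Z [V [U [AV AU -> ->]]]] ltc].
  by exists (alpha1 U0 * alpha2 V0), Z0, V0, U0.
have [t t0 [tU tV]] := balance (qnorm_ge0 I1 AU) (qnorm_ge0 I2 AV) ltc.
have [Ub Un] := @scale_bounded R k Y t (ltW t0).
have tV0 : 0 <= t^-1 by rewrite invr_ge0 ltW.
have [Vb Vn] := @scale_bounded R k Z t^-1 tV0.
exists Z, ((fun z : Z => of_real t^-1 *: z) \o V).
exists ((fun y : Y => of_real t *: y) \o U); split.
- exact: ideal_compl I2 _ _ _ _ _ AV Vb.
- exact: ideal_compl I1 _ _ _ _ _ AU Ub.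
- apply/funext => x /=; have [UL _] := ideal_bounded I1 AU.
  rewrite (operatorZ UL) scalerA -of_realM divff ?gt_eqF//.
  by rewrite of_real1 scale1r.
- exact: le_trans (qnorm_compl I1 AU Ub Un) tU.
- exact: le_trans (qnorm_compl I2 AV Vb Vn) tV.
Qed.

(** Both outer factors become sums of two operators, to which the additivity axioms of the two
    ideals apply separately. *)
Lemma sum_factorization (X Y Z1 Z2 : banach R k)
    (V1 : X -> Z1) (U1 : Z1 -> Y) (V2 : X -> Z2) (U2 : Z2 -> Y) :
  linear U1 -> linear U2 ->
  (U1 \o V1) \+ (U2 \o V2) = ((U1 \o fst) \+ (U2 \o snd)) \o
    (((fun z => (z, 0)) \o V1) \+ ((fun z => (0, z)) \o V2)).
Proof. by move=> L1 L2; apply/funext => x /=; rewrite addr0 add0r. Qed.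

Lemma class_comp_ideal : quasi_normed_ideal AA qn.
Proof.
split.
- move=> X Y _ [Z [V [U [AV AU ->]]]].
  by apply: bounded_operator_comp; [exact: ideal_bounded I2 _ _ _ AV|
    exact: ideal_bounded I1 _ _ _ AU].
- by exists K1, idfun, idfun; split=> //; [exact: ideal_id I2|exact: ideal_id I1].
- move=> X Y _ _ [Z1 [V1 [U1 [AV1 AU1 ->]]]] [Z2 [V2 [U2 [AV2 AU2 ->]]]].
  have [L1 _] := ideal_bounded I1 AU1; have [L2 _] := ideal_bounded I1 AU2.
  rewrite sum_factorization//.
  exists (Z1 * Z2)%type; do 2 eexists; split; last by [].
  + by apply: (ideal_add I2); apply: (ideal_compl I2) => //;
      [exact: (pairx0_bounded _ _).1|exact: (pair0x_bounded _ _).1].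
  + by apply: (ideal_add I1); apply: (ideal_compr I1) => //;
      [exact: (fst_bounded _ _).1|exact: (snd_bounded _ _).1].
- move=> W X Y Z S _ U Sb [Z0 [V0 [U0 [AV0 AU0 ->]]]] Ub.
  exists Z0, (V0 \o S), (U \o U0); split=> //.
    exact: ideal_compr I2 _ _ _ _ _ AV0 Sb.
  exact: ideal_compl I1 _ _ _ _ _ AU0 Ub.
- exact: product_qnorm_ge0.
- apply/eqP; rewrite eq_le; apply/andP; split.
    have := product_qnorm_le (ideal_id I2) (ideal_id I1).
    by rewrite (qnorm_id I1) (qnorm_id I2) mulr1.
  apply: lb_le_inf.
    exists (@alpha1 K1 K1 idfun * @alpha2 K1 K1 idfun), K1, idfun, idfun.
    by split=> //; [exact: ideal_id I2|exact: ideal_id I1].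
  (* For a factorization [U \o V] of the identity, [1 = alpha2 (U \o V) <= opnorm U * alpha2 V], and
     [opnorm U <= alpha1 U] because [U] is scalar-valued. *)
  move=> _ [Z [V [U [AV AU idE ->]]]].
  rewrite -(qnorm_id I2) idE.
  by apply: (qnorm_compl I2) => //; [exact: ideal_bounded I1 _ _ _ AU|
    exact: opnorm_functional_le I1 _ _ AU].
- have [k1 k1_1 k1P] := qnorm_add I1; have [k2 k2_1 k2P] := qnorm_add I2.
  have k1_0 : 0 <= k1 by apply: le_trans k1_1.
  have k2_0 : 0 <= k2 by apply: le_trans k2_1.
  have kk1 : 1 <= k1 * k2 by rewrite mulr_ege1.
  (* [k1] and [k2] come from the two quasi-triangle inequalities, and 2 from
     [(s + t)^2 <= 2 (s^2 + t^2)]. *)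
  exists (2 * (k1 * k2)); first by lra.
  move=> X Y S T AS AT; apply/ler_addgt0Pr => e e0.
  have kk0 : 0 < 2 * (k1 * k2) by lra.
  (* Each of [S] and [T] is allowed an excess [d] over its quasi-norm; the total
     [2 * (k1 * k2) * (d + d)] is [e]. *)
  pose d := e / (2 * (2 * (k1 * k2))).
  have d0 : 0 < d by rewrite divr_gt0 ?mulr_gt0//; lra.
  have [|Z1 [V1 [U1 [AV1 AU1 SE U1s V1s]]]] :=
    @balanced_factorization _ _ _ (qn S + d) AS; first by rewrite ltrDl.
  have [|Z2 [V2 [U2 [AV2 AU2 TE U2t V2t]]]] :=
    @balanced_factorization _ _ _ (qn T + d) AT; first by rewrite ltrDl.
  set s := Num.sqrt (qn S + d) in U1s V1s.
  set t := Num.sqrt (qn T + d) in U2t V2t.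
  have [L1 _] := ideal_bounded I1 AU1; have [L2 _] := ideal_bounded I1 AU2.
  have [i1b i1n] := pairx0_bounded Z1 Z2; have [i2b i2n] := pair0x_bounded Z1 Z2.
  have [p1b p1n] := fst_bounded Z1 Z2; have [p2b p2n] := snd_bounded Z1 Z2.
  have iV1 := ideal_compl I2 AV1 i1b; have iV2 := ideal_compl I2 AV2 i2b.
  have pU1 := ideal_compr I1 AU1 p1b; have pU2 := ideal_compr I1 AU2 p2b.
  rewrite {1}SE {1}TE sum_factorization//.
  apply: le_trans (product_qnorm_le (ideal_add I2 iV1 iV2) (ideal_add I1 pU1 pU2)) _.
  apply: le_trans (_ : (k1 * (s + t)) * (k2 * (s + t)) <= _).
    apply: ler_pM; rewrite ?(qnorm_ge0 I1) ?(qnorm_ge0 I2)//.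
    - exact: ideal_add I1 _ _ _ _ pU1 pU2.
    - exact: ideal_add I2 _ _ _ _ iV1 iV2.
    - apply: le_trans (k1P _ _ _ _ pU1 pU2) _; apply: ler_wpM2l => //.
      apply: lerD; [apply: le_trans U1s|apply: le_trans U2t].
        by rewrite -[leRHS]mulr1; exact: qnorm_compr I1 _ _ _ _ _ _ AU1 p1b p1n.
      by rewrite -[leRHS]mulr1; exact: qnorm_compr I1 _ _ _ _ _ _ AU2 p2b p2n.
    - apply: le_trans (k2P _ _ _ _ iV1 iV2) _; apply: ler_wpM2l => //.
      apply: lerD; [apply: le_trans V1s|apply: le_trans V2t].
        by rewrite -[leRHS]mul1r; exact: qnorm_compl I2 _ _ _ _ _ _ AV1 i1b i1n.
      by rewrite -[leRHS]mul1r; exact: qnorm_compl I2 _ _ _ _ _ _ AV2 i2b i2n.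
  have sE : s ^+ 2 = qn S + d
    by rewrite sqr_sqrtr// addr_ge0 ?product_qnorm_ge0 ?(ltW d0).
  have tE : t ^+ 2 = qn T + d
    by rewrite sqr_sqrtr// addr_ge0 ?product_qnorm_ge0 ?(ltW d0).
  have -> : e = 2 * (k1 * k2) * (d + d).
    by rewrite /d; field; rewrite !gt_eqF//; lra.
  rewrite -mulrDr addrACA -sE -tE mulrACA -expr2 [2 * _]mulrC -[leRHS]mulrA.
  rewrite ler_wpM2l ?mulr_ge0//.
  (* What remains is [(s + t)^2 <= 2 (s^2 + t^2)]. *)
  by have := sqr_ge0 (s - t); nra.
- move=> W X Y Z S T U Sb AT Ub.
  rewrite mulrAC; apply: le_mul_inf.
  + by rewrite mulr_ge0 ?opnorm_ge0.
  + by have [Z0 [V0 [U0 [AV0 AU0 T0]]]] := AT;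
    exists (alpha1 U0 * alpha2 V0), Z0, V0, U0.
  move=> _ [Z0 [V0 [U0 [AV0 AU0 -> ->]]]].
  have AV := ideal_compr I2 AV0 Sb; have AU := ideal_compl I1 AU0 Ub.
  apply: le_trans (product_qnorm_le AV AU) _.
  rewrite mulrACA [opnorm S * _]mulrC.
  apply: ler_pM; rewrite ?(qnorm_ge0 I1)// ?(qnorm_ge0 I2)//.
    exact: qnorm_compl I1 _ _ _ _ _ _ AU0 Ub (lexx _).
  exact: qnorm_compr I2 _ _ _ _ _ _ AV0 Sb (lexx _).
Qed.

End product_ideal.

(** * Injectivity of the product ideal *)

Lemma class_comp_injective (R : realType) (k : scalar_kind)
    (A1 A2 : operator_class R k) (alpha1 alpha2 : operator_qnorm R k) :
  quasi_normed_ideal A1 alpha1 -> quasi_normed_ideal A2 alpha2 ->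
  injective_class A1 -> injective_class A2 ->
  injective_class (class_comp A1 A2).
Proof.
move=> I1 I2 inj1 inj2; have I := class_comp_ideal I1 I2.
apply: functional_extensionality_dep => X; apply: functional_extensionality_dep => Y.
pose i := @canonical_embedding R k Y.
have ib : bounded_operator i by exact: canonical_embedding_bounded.
have [iL ic] := ib.
apply/seteqP; split => T; last first.
  move=> AT; split; first exact: ideal_bounded I _ _ _ AT.
  exact: (ideal_compl (Z := linfty R k (dual_ball Y)) I AT ib).
move=> [[TL Tc] [Z [V [U [AV AU iTE]]]]].
have [VL Vc] := ideal_bounded I2 AV; have [UL Uc] := ideal_bounded I1 AU.
have UV x : U (V x) = i (T x) by have := congr1 (@^~ x) iTE.
pose P : {pred Z} := mem (U @^-1` range i).
have PE z : (z \in P) <-> exists y, U z = i y.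
  split; first by move=> /set_mem[y _ <-]; exists y.
  by move=> [y Uz]; apply/mem_set; exists y.
have Psub : submod_closed P.
  split; first by apply/PE; exists 0; rewrite (operator0 UL) (operator0 iL).
  move=> a z w /PE[y Uz] /PE[y' Uw]; apply/PE; exists (a *: y + y').
  by rewrite UL iL Uz Uw.
have Pcl : closed [set z | z \in P].
  rewrite (_ : [set z | z \in P] = U @^-1` range i); last first.
    by apply/seteqP; split => z; [move/set_mem|move/mem_set].
  apply: closed_comp; first by move=> z _; exact: Uc.
  exact: isometry_closed_range ib (@canonical_embedding_norm R k Y).
pose S := ClosedSubmodule Psub Pcl.
have VP x : V x \in carrier S by apply/PE; exists (T x).
pose V0 x : submodule S := Submodule (VP x).
have WE (z : submodule S) : exists y, U (submodule_val z) = i y.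
  exact/PE/submodule_valP.
(* Preimages under [i] are merely chosen here. Linearity of [W] follows because [i] is linear and
   one-to-one, and the bound [opnorm U] because [i] is isometric. *)
have [W WP] := choice WE.
have i_inj : injective i by exact: canonical_embedding_inj.
have [valb _] : bounded_operator (@submodule_val _ _ S) /\
    opnorm (@submodule_val _ _ S) <= 1.
  exact: contraction_bounded.
exists (submodule S), V0, W; split.
(* Rewriting [A2] as its hull leaves two goals: [V0] is bounded, and its composite with the
   embedding of [submodule S], which equals [E \o V], lies in [A2]. *)
- rewrite -inj2; split.
    have V0L : linear V0 by move=> a x y; apply: val_inj; exact: VL.
    apply: (bounded_operator_le V0L (M := opnorm V)) => x.
    exact: le_opnorm (ideal_bounded I2 AV).
  have [E Eb EE] := canonical_embedding_extension S.
  rewrite (_ : _ \o _ = E \o V); first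
    exact: (ideal_compl (Z := linfty R k (dual_ball (submodule S))) I2 AV Eb).
  by apply/funext => x /=; rewrite -EE.
(* Likewise for [A1], where the composite [i \o W] is [U] restricted to the subspace. *)
- rewrite -inj1; split.
    have WL : linear W.
      by move=> a z w; apply: i_inj; rewrite iL -!WP; exact: UL.
    apply: (bounded_operator_le WL (M := opnorm U)) => z.
    have -> : real_norm (W z) = real_norm (U (submodule_val z)).
      by rewrite WP /real_norm canonical_embedding_norm.
    exact: le_opnorm (ideal_bounded I1 AU).
  rewrite (_ : _ \o _ = U \o @submodule_val _ _ S).
    exact: (ideal_compr (W := submodule S) I1 AU valb).
  by apply/funext => z /=; rewrite WP.
- by apply/funext => x; apply: i_inj; rewrite -UV /= -WP.
Qed.

Theorem theorem3p3 (R : realType) (k : scalar_kind)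
    (A1 A2 : operator_class R k) (alpha1 alpha2 : operator_qnorm R k) :
  quasi_normed_ideal A1 alpha1 -> quasi_normed_ideal A2 alpha2 ->
  injective_class A1 -> injective_class A2 ->
  quasi_normed_ideal (class_comp A1 A2) (product_qnorm A1 A2 alpha1 alpha2) /\
  injective_class (class_comp A1 A2).
Proof.
move=> I1 I2 inj1 inj2; split; first exact: class_comp_ideal.
exact: class_comp_injective I1 I2 inj1 inj2.
Qed.
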